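(* Let $\mathcal{H}=(X;\tau_0,\tau_1,\tau_2)$ be a hypermap and let $A\subseteq\mathcal{E}(\mathcal{H})$. Then the partial dual $\mathcal{H}^A$ is Eulerian if and only if there exist a crossing-total orientation $\Omega$ of the medial map $M(\mathcal{H})$ and a set $T'\subseteq T(\Omega)$ such that $A=D(\Omega)\cup T'$.
   Context: A hypermap is a triple $\mathcal{H}=(X;\tau_0,\tau_1,\tau_2)$ where $X$ is a finite set (of flags), each $\tau_i$ is a fixed-point-free involution on $X$, and $\langle\tau_0,\tau_1,\tau_2\rangle$ acts transitively on $X$. Its vertices, hyperedges and faces are the orbits: $\mathcal{V}(\mathcal{H})=X/\langle\tau_1,\tau_2\rangle$, $\mathcal{E}(\mathcal{H})=X/\langle\tau_0,\tau_2\rangle$, $\mathcal{F}(\mathcal{H})=X/\langle\tau_0,\tau_1\rangle$. The valence of a vertex, hyperedge or face is half the cardinality of the orbit. $\mathcal{H}$ is Eulerian if every vertex has even valence. Partial dual: for $A\subseteq\mathcal{E}(\mathcal{H})$ let $X_A=\bigcup_{e\in A}e\subseteq X$. Then $\mathcal{H}^A=(X;\tau_0^A,\tau_1,\tau_2^A)$, where for $x\in X_A$: $\tau_0^A(x)=\tau_2(x)$, $\tau_2^A(x)=\tau_0(x)$; and for $x\notin X_A$: $\tau_0^A(x)=\tau_0(x)$, $\tau_2^A(x)=\tau_2(x)$. Medial map: $M(\mathcal{H})=(Y;\mu_0,\mu_1,\mu_2)$ with $Y=X\times\{\mathsf b,\mathsf w\}$, $\mu_0(x,c)=(\tau_1x,c)$,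 $\mu_2(x,c)=(x,\bar c)$ (where $\bar c$ is the symbol other than $c$), $\mu_1(x,\mathsf b)=(\tau_2x,\mathsf b)$, $\mu_1(x,\mathsf w)=(\tau_0x,\mathsf w)$. Its vertices (medial vertices) are the sets $e\times\{\mathsf b,\mathsf w\}$ for $e\in\mathcal{E}(\mathcal{H})$, and so are identified with hyperedges; its half-edges $\{(x,\mathsf b),(x,\mathsf w)\}$ are identified with the flags $x\in X$, the half-edge $x$ being incident with the medial vertex $e\ni x$; its edges (medial edges) correspond to the pairs $\{x,\tau_1x\}$, the two half-edges of such an edge being $x$ and $\tau_1x$. An orientation $\Omega$ of $M(\mathcal{H})$ is a choice of direction for each medial edge. For $x\in X$ set $\delta_\Omega(x)=+1$ if the medial edge $\{x,\tau_1x\}$ is directed away from the medial vertex at its end $x$, and $\delta_\Omega(x)=-1$ if it is directed towards it; thus orientations correspond exactly to maps $\delta_\Omega:X\to\{+1,-1\}$ with $\delta_\Omega(\tau_1x)=-\delta_\Omega(x)$ for all $x$. Types of a hyperedge $e$ with respect to $\Omega$: $e$ is of $t$-type if $\delta_\Omega$ is constant on $e$; $e$ is of $c$-type if it is not of $t$-type and $\delta_\Omega(\tau_2x)=\delta_\Omega(x)$ for every $x\in e$; $e$ is of $d$-type if it is not of $t$-type and $\delta_\Omega(\tau_0x)=\delta_\Omega(x)$ for every $x\in e$. The orientation $\Omega$ is crossing-total if every hyperedge is of one of these three types. $D(\Omega)$ and $T(\Omega)$ denote the sets of $d$-type and $t$-type hyperedges, respectively. *)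

(* Defs.v *)
From HB Require Import structures.
From mathcomp Require Import all_boot all_order all_algebra all_fingroup.
Set Implicit Arguments. Unset Strict Implicit. Unset Printing Implicit Defensive.
Import GRing.Theory.

Definition ff_involution (X : finType) (t : {perm X}) : Prop :=
  involutive t /\ forall x, t x != x.

Record hypermap (X : finType) := Hypermap {
  tau0 : {perm X};
  tau1 : {perm X};
  tau2 : {perm X};
  tau0_ffi : ff_involution tau0;
  tau1_ffi : ff_involution tau1;
  tau2_ffi : ff_involution tau2;
  tau_trans :
    [transitive <<[set tau0; tau1; tau2]>>%g, on [set: X] | 'P%act] }.

Section Cells.
Variables (X : finType) (H : hypermap X).

Definition vertex_of (x : X) : {set X} :=
  orbit 'P%act <<[set tau1 H; tau2 H]>>%g x.
Definition hyperedge_of (x : X) : {set X} :=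
  orbit 'P%act <<[set tau0 H; tau2 H]>>%g x.

Definition vertices : {set {set X}} := [set vertex_of x | x : X].
Definition hyperedges : {set {set X}} := [set hyperedge_of x | x : X].

Definition valence (o : {set X}) : nat := #|o|./2.

Definition eulerian : Prop := forall v, v \in vertices -> ~~ odd (valence v).

End Cells.

Section OrbitFacts.
Variable X : finType.
Implicit Types (S : {set {perm X}}) (x y : X).

Lemma gen_orbit_ind S (P : pred X) x y :
  (forall s z, s \in S -> P z -> P (s z)) ->
  P x -> y \in orbit 'P%act <<S>>%g x -> P y.
Proof.
move=> PS Px /orbitP[p /gen_prodgP[n [c cS ->]] <-] /=; rewrite /aperm.
elim: n c cS => [|n IHn] c cS; first by rewrite big_ord0 perm1.
rewrite big_ord_recr permM; apply: PS => //.
exact: (IHn (fun i => c (widen_ord (leqnSn n) i))).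
Qed.

Lemma gen_orbit_step S s x y :
  s \in S -> y \in orbit 'P%act <<S>>%g x -> s y \in orbit 'P%act <<S>>%g x.
Proof.
move=> sS yx; apply: orbit_trans yx.
by apply/orbitP; exists s => //; apply: mem_gen.
Qed.

Lemma gen_transP S x0 :
  reflect (forall x y, y \in orbit 'P%act <<S>>%g x)
          [transitive <<S>>%g, on [set: X] | 'P%act].
Proof.
apply: (iffP idP) => [tr x y | all_orb].
  by rewrite (atransP tr) ?inE.
apply/imsetP; exists x0 => //; apply/setP=> y.
by rewrite inE all_orb.
Qed.

Lemma hypermap_point (H : hypermap X) : exists x : X, true.
Proof. by case/imsetP: (tau_trans H) => x _ _; exists x. Qed.

End OrbitFacts.

Section PartialDual.
Variables (X : finType) (H : hypermap X) (A : {set {set X}}).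
Hypothesis hA : A \subset hyperedges H.

Definition pdual0_fun (x : X) : X :=
  if x \in cover A then tau2 H x else tau0 H x.
Definition pdual2_fun (x : X) : X :=
  if x \in cover A then tau0 H x else tau2 H x.

Lemma cover_step s x :
  s \in [set tau0 H; tau2 H] -> x \in cover A -> s x \in cover A.
Proof.
move=> sS /bigcupP[e eA xe]; apply/bigcupP; exists e => //.
have /imsetP[z _ Ee] := subsetP hA _ eA.
by rewrite Ee in xe *; apply: gen_orbit_step.
Qed.

Lemma cover_tau0 x : (tau0 H x \in cover A) = (x \in cover A).
Proof.
have s0 : tau0 H \in [set tau0 H; tau2 H] by rewrite !inE eqxx.
apply/idP/idP => [/(cover_step s0)|]; last exact: cover_step.
by rewrite (tau0_ffi H).1.
Qed.

Lemma cover_tau2 x : (tau2 H x \in cover A) = (x \in cover A).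
Proof.
have s2 : tau2 H \in [set tau0 H; tau2 H] by rewrite !inE eqxx orbT.
apply/idP/idP => [/(cover_step s2)|]; last exact: cover_step.
by rewrite (tau2_ffi H).1.
Qed.

Lemma pdual0_funK : involutive pdual0_fun.
Proof.
move=> x; rewrite /pdual0_fun; case xA: (x \in cover A).
  by rewrite cover_tau2 xA (tau2_ffi H).1.
by rewrite cover_tau0 xA (tau0_ffi H).1.
Qed.

Lemma pdual2_funK : involutive pdual2_fun.
Proof.
move=> x; rewrite /pdual2_fun; case xA: (x \in cover A).
  by rewrite cover_tau0 xA (tau0_ffi H).1.
by rewrite cover_tau2 xA (tau2_ffi H).1.
Qed.

Definition pdual_tau0 : {perm X} := perm (inv_inj pdual0_funK).
Definition pdual_tau2 : {perm X} := perm (inv_inj pdual2_funK).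

Lemma pdual_tau0_ffi : ff_involution pdual_tau0.
Proof.
split=> [x|x]; rewrite !permE; first exact: pdual0_funK.
rewrite /pdual0_fun; case: ifP => _; [exact: (tau2_ffi H).2|exact: (tau0_ffi H).2].
Qed.

Lemma pdual_tau2_ffi : ff_involution pdual_tau2.
Proof.
split=> [x|x]; rewrite !permE; first exact: pdual2_funK.
rewrite /pdual2_fun; case: ifP => _; [exact: (tau0_ffi H).2|exact: (tau2_ffi H).2].
Qed.

Lemma pdual_trans :
  [transitive <<[set pdual_tau0; tau1 H; pdual_tau2]>>%g,
     on [set: X] | 'P%act].
Proof.
have [x0 _] := hypermap_point H; apply/(gen_transP _ x0) => x y.
have Hxy : y \in orbit 'P%act <<[set tau0 H; tau1 H; tau2 H]>>%g x.
  exact: (gen_transP _ x0 (tau_trans H)).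
set S := [set pdual_tau0; _; _].
pose P z := z \in orbit 'P%act <<S>>%g x.
have s0 : pdual_tau0 \in S by rewrite !inE eqxx.
have s1 : tau1 H \in S by rewrite !inE eqxx orbT.
have s2 : pdual_tau2 \in S by rewrite !inE eqxx !orbT.
apply: (@gen_orbit_ind _ _ P _ _ _ _ Hxy); last exact: orbit_refl.
move=> s z; rewrite /P !inE => /orP[/orP[]|] /eqP-> Pz.
- have := gen_orbit_step s0 Pz; have := gen_orbit_step s2 Pz.
  by rewrite !permE /pdual0_fun /pdual2_fun; case: ifP.
- exact: gen_orbit_step Pz.
have := gen_orbit_step s0 Pz; have := gen_orbit_step s2 Pz.
by rewrite !permE /pdual0_fun /pdual2_fun; case: ifP.
Qed.

Definition partial_dual : hypermap X :=
  Hypermap pdual_tau0_ffi (tau1_ffi H) pdual_tau2_ffi pdual_trans.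

End PartialDual.

(* The colours b and w of the flags of the medial map are [true] and [false]. *)
Section Medial.
Variables (X : finType) (H : hypermap X).

Definition mu0_fun (y : X * bool) : X * bool := (tau1 H y.1, y.2).
Definition mu1_fun (y : X * bool) : X * bool :=
  (if y.2 then tau2 H y.1 else tau0 H y.1, y.2).
Definition mu2_fun (y : X * bool) : X * bool := (y.1, ~~ y.2).

Lemma mu0_funK : involutive mu0_fun.
Proof. by case=> x c; rewrite /mu0_fun /= (tau1_ffi H).1. Qed.
Lemma mu1_funK : involutive mu1_fun.
Proof.
by case=> x [] /=; rewrite /mu1_fun /= ?(tau2_ffi H).1 ?(tau0_ffi H).1.
Qed.
Lemma mu2_funK : involutive mu2_fun.
Proof. by case=> x c; rewrite /mu2_fun /= negbK. Qed.

Definition mu0 : {perm X * bool} := perm (inv_inj mu0_funK).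
Definition mu1 : {perm X * bool} := perm (inv_inj mu1_funK).
Definition mu2 : {perm X * bool} := perm (inv_inj mu2_funK).

Lemma mu0_ffi : ff_involution mu0.
Proof.
split=> [y|[x c]]; rewrite !permE; first exact: mu0_funK.
by rewrite xpair_eqE negb_and (tau1_ffi H).2.
Qed.
Lemma mu1_ffi : ff_involution mu1.
Proof.
split=> [y|[x c]]; rewrite !permE; first exact: mu1_funK.
by rewrite xpair_eqE negb_and /=; case: c; rewrite ?(tau2_ffi H).2 ?(tau0_ffi H).2.
Qed.
Lemma mu2_ffi : ff_involution mu2.
Proof.
split=> [y|[x c]]; rewrite !permE; first exact: mu2_funK.
by rewrite xpair_eqE negb_and; case: c; rewrite orbT.
Qed.

Lemma mu_trans :
  [transitive <<[set mu0; mu1; mu2]>>%g, on [set: X * bool] | 'P%act].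
Proof.
have [x0 _] := hypermap_point H.
apply/(gen_transP _ (x0, true)) => -[x c] [y d].
have Hxy : y \in orbit 'P%act <<[set tau0 H; tau1 H; tau2 H]>>%g x.
  exact: (gen_transP _ x0 (tau_trans H)).
set S := [set mu0; _; _].
pose O := orbit 'P%act <<S>>%g (x, c).
have step0 z b : (z, b) \in O -> (tau1 H z, b) \in O.
  have s : mu0 \in S by rewrite !inE eqxx.
  by move/(gen_orbit_step s); rewrite permE.
have step1 z b : (z, b) \in O ->
    (if b then tau2 H z else tau0 H z, b) \in O.
  have s : mu1 \in S by rewrite !inE eqxx orbT.
  by move/(gen_orbit_step s); rewrite permE.
have step2 z b : (z, b) \in O -> (z, ~~ b) \in O.
  have s : mu2 \in S by rewrite !inE eqxx !orbT.
  by move/(gen_orbit_step s); rewrite permE.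
have all2 z b b' : (z, b) \in O -> (z, b') \in O.
  by case: b b' => [] [] // /step2.
apply: (all2 _ true).
apply: (@gen_orbit_ind _ _ (fun z => (z, true) \in O) _ _ _ _ Hxy).
  move=> s z; rewrite !inE => /orP[/orP[]|] /eqP-> zO.
  - exact: all2 (step1 _ _ (all2 _ _ false zO)).
  - exact: step0.
  exact: (step1 _ _ zO).
by apply: (all2 _ c); apply: orbit_refl.
Qed.

Definition medial : hypermap (X * bool)%type :=
  Hypermap mu0_ffi mu1_ffi mu2_ffi mu_trans.

End Medial.

Definition half_edge_of (Y : finType) (M : hypermap Y) (y : Y) : {set Y} :=
  orbit 'P%act <[tau2 M]>%g y.

(* An edge of a map is an orbit of <tau0, tau2> and consists of two half-edges,
   the orbits of <tau2>.  Directing the edge amounts to choosing which of them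
   is its tail; this also makes sense for loops.  The values of [tail] on sets
   that are not edges are irrelevant. *)
Record orientation (Y : finType) (M : hypermap Y) := Orientation {
  tail : {set Y} -> {set Y};
  tailP : forall e, e \in hyperedges M ->
    exists2 y, y \in e & tail e = half_edge_of M y }.

Section Types.
Variables (X : finType) (H : hypermap X) (Omega : orientation (medial H)).

(* The flag x stands for the half-edge {(x, b), (x, w)} of the medial map: the
   medial edge containing it leaves the medial vertex at the end x iff that
   half-edge is the tail. *)
Definition delta (x : X) : int :=
  if tail Omega (hyperedge_of (medial H) (x, true))
       == half_edge_of (medial H) (x, true)
  then 1%R else (-1)%R.

Definition t_type (e : {set X}) : bool :=
  [forall x in e, forall y in e, delta x == delta y].
Definition c_type (e : {set X}) : bool :=
  ~~ t_type e && [forall x in e, delta (tau2 H x) == delta x].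
Definition d_type (e : {set X}) : bool :=
  ~~ t_type e && [forall x in e, delta (tau0 H x) == delta x].

Definition crossing_total : Prop :=
  forall e, e \in hyperedges H -> [|| t_type e, c_type e | d_type e].

Definition d_set : {set {set X}} := [set e in hyperedges H | d_type e].
Definition t_set : {set {set X}} := [set e in hyperedges H | t_type e].

End Types.

Section MedialFacts.
Variables (X : finType) (H : hypermap X).

Lemma medial_half_edgeE x c :
  half_edge_of (medial H) (x, c) = [set (x, true); (x, false)].
Proof.
apply/setP=> -[z d]; rewrite !inE !xpair_eqE -andb_orr orbC.
have -> : (d == false) || (d == true) by case: d.
rewrite andbT; apply/idP/eqP => [|->].
  move=> /(@gen_orbit_ind _ _ (fun y : X * bool => y.1 == x)) h.
  apply/eqP; apply: h => //= s [u b]; rewrite inE => /eqP->.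
  by rewrite permE.
have [->|] := eqVneq d c; first exact: orbit_refl.
move=> dc; have -> : (x, d) = tau2 (medial H) (x, c).
  by rewrite permE /mu2_fun /=; case: d c dc => [] [].
by apply: gen_orbit_step; rewrite ?inE ?orbit_refl.
Qed.

Lemma medial_edgeE x c :
  hyperedge_of (medial H) (x, c)
  = [set (x, true); (x, false); (tau1 H x, true); (tau1 H x, false)].
Proof.
apply/setP=> -[z d]; apply/idP/idP => [|zd].
  move=> /(@gen_orbit_ind _ _
    (fun y => y \in [set (x, true); (x, false); (tau1 H x, true);
                         (tau1 H x, false)])) h.
  apply: h; last by rewrite !inE !xpair_eqE eqxx; case: c.
  move=> s [u b]; rewrite !inE => /orP[] /eqP-> /=; rewrite permE;
    move=> /orP[/orP[/orP[]|]|] /eqP[-> ->];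
    by rewrite !xpair_eqE /= ?(tau1_ffi H).1 ?eqxx ?orbT.
set O := hyperedge_of _ _.
have i0 : tau0 (medial H) \in [set tau0 (medial H); tau2 (medial H)] by rewrite !inE eqxx.
have i2 : tau2 (medial H) \in [set tau0 (medial H); tau2 (medial H)] by rewrite !inE eqxx orbT.
have xO b : (x, b) \in O.
  have [->|bc] := eqVneq b c; first exact: orbit_refl.
  have -> : (x, b) = tau2 (medial H) (x, c).
    by rewrite permE /mu2_fun /=; move: (b) (c) bc => [] [].
  by apply: gen_orbit_step; rewrite ?orbit_refl.
have x1O b : (tau1 H x, b) \in O.
  by have := gen_orbit_step i0 (xO b); rewrite permE.
by move: zd; rewrite !inE => /orP[/orP[/orP[]|]|] /eqP->.
Qed.

Lemma delta_tau1 (Omega : orientation (medial H)) x :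
  delta Omega (tau1 H x) = (- delta Omega x)%R.
Proof.
rewrite /delta.
have E : hyperedge_of (medial H) (tau1 H x, true)
       = hyperedge_of (medial H) (x, true).
  rewrite !medial_edgeE (tau1_ffi H).1; apply/setP=> y; rewrite !inE.
  by do !case: (_ == _).
have halfNe : half_edge_of (medial H) (tau1 H x, true)
           != half_edge_of (medial H) (x, true).
  rewrite !medial_half_edgeE; apply/eqP=> /setP/(_ (tau1 H x, true)).
  by rewrite !inE !xpair_eqE eqxx (negbTE ((tau1_ffi H).2 x)).
rewrite E; have [|[z d]] := @tailP _ _ Omega (hyperedge_of (medial H) (x, true)).
  exact: imset_f.
have hE u : half_edge_of (medial H) (u, false) = half_edge_of (medial H) (u, true).
  by rewrite !medial_half_edgeE.
rewrite medial_edgeE !inE => h ->.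
by case/orP: h => [/orP[/orP[]|]|] /eqP->; rewrite ?hE eqxx
  1?(negbTE halfNe) 1?eq_sym 1?(negbTE halfNe) ?opprK.
Qed.

Lemma delta_exists (f : X -> int) :
  (forall x, f x = 1%R \/ f x = (-1)%R) ->
  (forall x, f (tau1 H x) = (- f x)%R) ->
  exists Omega : orientation (medial H), forall x, delta Omega x = f x.
Proof.
move=> f1 fN.
have hE u c : half_edge_of (medial H) (u, c) = half_edge_of (medial H) (u, true).
  by rewrite !medial_half_edgeE.
pose tl (e : {set X * bool}) := [set y in e | f y.1 == 1%R].
have fE x : (f (tau1 H x) == 1%R) = (f x != 1%R).
  by rewrite fN; case: (f1 x) => ->.
have tlE x : tl (hyperedge_of (medial H) (x, true)) =
    half_edge_of (medial H) (if f x == 1%R then x else tau1 H x, true).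
  rewrite medial_edgeE medial_half_edgeE; apply/setP=> -[z d].
  rewrite !inE !xpair_eqE /=.
  have [->|nx] := eqVneq z x.
    rewrite [x == tau1 _ _]eq_sym (negbTE ((tau1_ffi H).2 x)).
    case: (f x == 1%R); rewrite ?eqxx ?andbT ?andbF ?orbF //.
    by rewrite [x == tau1 _ _]eq_sym (negbTE ((tau1_ffi H).2 x)).
  have [->|nx1] := eqVneq z (tau1 H x).
    rewrite fE; case: (f x == 1%R) => /=; last by rewrite eqxx andbT.
    by rewrite (negbTE ((tau1_ffi H).2 x)) andbF.
  by case: (f x == 1%R); rewrite ?(negbTE nx) ?(negbTE nx1).
have tlP e : e \in hyperedges (medial H) ->
    exists2 y, y \in e & tl e = half_edge_of (medial H) y.
  case/imsetP=> -[x c] _ ->.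
  have -> : hyperedge_of (medial H) (x, c) = hyperedge_of (medial H) (x, true).
    by rewrite !medial_edgeE.
  exists (if f x == 1%R then x else tau1 H x, true); last exact: tlE.
  by rewrite medial_edgeE !inE !xpair_eqE; case: ifP; rewrite !eqxx ?orbT.
exists (Orientation tlP) => x; rewrite /delta /= tlE.
case: (f1 x) => -> /=; first by rewrite eqxx.
case: eqP => // /setP/(_ (x, true)).
by rewrite !medial_half_edgeE !inE !xpair_eqE eqxx [x == _]eq_sym
  (negbTE ((tau1_ffi H).2 x)) eqxx.
Qed.

Lemma medial_vertexE x c :
  vertex_of (medial H) (x, c) = setX (hyperedge_of H x) setT.
Proof.
have v1 z b : (z, b) \in vertex_of (medial H) (x, c) ->
   (if b then tau2 H z else tau0 H z, b) \in vertex_of (medial H) (x, c).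
  have s : tau1 (medial H) \in [set tau1 (medial H); tau2 (medial H)] by rewrite !inE eqxx.
  by move/(gen_orbit_step s); rewrite permE.
have v2 z b b' : (z, b) \in vertex_of (medial H) (x, c) ->
   (z, b') \in vertex_of (medial H) (x, c).
  have s : tau2 (medial H) \in [set tau1 (medial H); tau2 (medial H)] by rewrite !inE eqxx orbT.
  by case: b b' => [] [] // /(gen_orbit_step s); rewrite permE.
apply/setP=> -[z d]; rewrite !inE andbT; apply/idP/idP.
  apply: (@gen_orbit_ind _ _ (fun y : X * bool => y.1 \in hyperedge_of H x));
    last exact: orbit_refl.
  move=> s [u b] /=; rewrite !inE => /orP[] /eqP-> uO; rewrite permE //=.
  by case: b; apply: gen_orbit_step uO; rewrite !inE eqxx ?orbT.
move=> zx; apply: (@gen_orbit_ind _ _ (fun z => (z, d) \in vertex_of (medial H) (x, c))) zx.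
  move=> s u; rewrite !inE => /orP[] /eqP-> uO.
    exact: v2 (v1 _ _ (v2 _ _ false uO)).
  exact: v2 (v1 _ _ (v2 _ _ true uO)).
by apply: (v2 _ c); apply: orbit_refl.
Qed.
End MedialFacts.

(* Main.v *)
Require Import Defs.
From mathcomp Require Import all_boot all_order all_algebra all_fingroup.
Set Implicit Arguments. Unset Strict Implicit. Unset Printing Implicit Defensive.

(** Call a set P of flags an alternating set for the pair of involutions (a, b)
    if a exchanges P with its complement and b preserves P.  An orientation of
    the medial map is a sign delta with delta (tau1 x) = - delta x, hence a set
    P of positive flags that tau1 exchanges with its complement.

    - A vertex of a hypermap with n = valence is a 2n-cycle of flags joined
      alternately by tau1 and tau2.  A sign that changes along the tau1-steps
      and persists along the tau2-steps changes n times around the cycle, so it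
      exists exactly when n is even.  Hence a hypermap is Eulerian iff
      (tau1, tau2) has an alternating set ([alternating_setP]).

    - The involution tau2 of the partial dual is tau0 on the hyperedges in A
      and tau2 on the others.  So the partial dual is Eulerian iff some
      orientation has delta invariant under tau0 on the hyperedges in A and
      under tau2 off A.  On a hyperedge, invariance under tau0 means t-type or
      d-type, invariance under tau2 means t-type or c-type, and invariance
      under both means t-type: so the condition says that the orientation is
      crossing-total, that all d-type hyperedges are in A and that all c-type
      ones are not, the t-type ones being free. *)

(** * Alternating sets for a pair of involutions *)

Section Alternating.

Variable X : finType.
Implicit Types (a b t s : {perm X}) (P S : {set X}).

Lemma card_swap t S P :
  (forall x, x \in S -> t x \in S) -> involutive t ->
  (forall x, x \in S -> (t x \in P) = (x \notin P)) ->
  #|S| = (#|S :&: P|).*2.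
Proof.
move=> tS tK tP; rewrite -(cardsID P S) -addnn; congr (_ + _).
rewrite -(card_imset (S :&: P) (@perm_inj _ t)); apply: eq_card => y.
apply/idP/idP => [|/imsetP[x /setIP[xS xP] ->]]; last first.
  by rewrite !inE tS // tP // xP.
rewrite !inE => /andP[yP yS]; rewrite -(tK y); apply: imset_f.
by rewrite inE tS // tP.
Qed.

(** In each pair {x, t x} the flag with the smaller rank is picked: t exchanges
    the picked flags with the others. *)
Lemma ff_involution_even t S :
  ff_involution t -> (forall x, x \in S -> t x \in S) -> ~~ odd #|S|.
Proof.
move=> [tK tF] tS.
rewrite (@card_swap t S [set x | enum_rank x < enum_rank (t x)]) ?odd_double //.
move=> x _; rewrite !inE tK -leqNgt ltn_neqAle.
by rewrite (inj_eq val_inj) (inj_eq enum_rank_inj) tF.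
Qed.

Lemma card_porbit_le s k x : 0 < k -> (s ^+ k)%g x = x -> #|porbit s x| <= k.
Proof.
move=> k_gt0 skx; apply: (@leq_trans #|[set (s ^+ i)%g x | i : 'I_k]|).
  apply/subset_leq_card/subsetP => y /porbitP[i ->].
  have fix_mul j : (s ^+ (j * k))%g x = x.
    by elim: j => [|j IHj]; rewrite ?perm1 // mulSn expgD permM skx.
  apply/imsetP; exists (Ordinal (ltn_pmod i k_gt0)) => //=.
  by rewrite {1}(divn_eq i k) expgD permM fix_mul.
by rewrite -[leqRHS]card_ord leq_imset_card.
Qed.

Lemma mem_porbit_step s x y : (s y \in porbit s x) = (y \in porbit s x).
Proof. by rewrite -!eq_porbit_mem (porbit_perm s 1). Qed.

Definition dihedral_orbit a b x := orbit 'P%act <<[set a; b]>>%g x.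

Lemma dihedral_orbit_stepl a b x y :
  y \in dihedral_orbit a b x -> a y \in dihedral_orbit a b x.
Proof. by apply: gen_orbit_step; rewrite !inE eqxx. Qed.

Lemma dihedral_orbit_stepr a b x y :
  y \in dihedral_orbit a b x -> b y \in dihedral_orbit a b x.
Proof. by apply: gen_orbit_step; rewrite !inE eqxx orbT. Qed.

Lemma dihedral_orbit_sub a b x S : x \in S ->
  (forall y, y \in S -> a y \in S) -> (forall y, y \in S -> b y \in S) ->
  dihedral_orbit a b x \subset S.
Proof.
move=> xS aS bS; apply/subsetP => y; apply: gen_orbit_ind => // s z.
by rewrite !inE => /orP[] /eqP->; [apply: aS | apply: bS].
Qed.

Lemma dihedral_orbit_eq a b x y :
  y \in dihedral_orbit a b x -> dihedral_orbit a b y = dihedral_orbit a b x.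
Proof. by move/orbit_eqP. Qed.

Section Pair.

Variables a b : {perm X}.
Hypotheses (a_ffi : ff_involution a) (b_ffi : ff_involution b).

Let aK : involutive a. Proof. exact: a_ffi.1. Qed.
Let bK : involutive b. Proof. exact: b_ffi.1. Qed.

(** The permutation a * b sends x to b (a x): it moves one step around the
    dihedral cycle, along every second flag. *)
Let rho := (a * b)%g.

Let rhoE x : rho x = b (a x). Proof. exact: permM. Qed.

Let rhoVE x : rho^-1%g x = a (b x).
Proof. by apply: (@perm_inj _ rho); rewrite permKV rhoE aK bK. Qed.

(** A rotation followed by a is a reflection, hence conjugate to a or to b, so
    it has no fixed point. *)
Lemma rotation_neq_reflection k x : (rho ^+ k)%g x != a x.
Proof.
elim/ltn_ind: k x => -[|[|k]] IHk x.
- by rewrite perm1 eq_sym a_ffi.2.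
- by rewrite expg1 rhoE b_ffi.2.
rewrite expgS permM expgSr permM; apply: contra (IHk k _ (rho x)) => // /eqP e.
by apply/eqP/(@perm_inj _ rho); rewrite e !rhoE aK bK.
Qed.

Lemma reflection_notin_porbit x y : y \in porbit rho x -> a y \notin porbit rho x.
Proof.
rewrite -eq_porbit_mem => /eqP <-; apply/negP => /porbitP[k] /esym /eqP.
exact/negP/rotation_neq_reflection.
Qed.

(** The rho-cycle of x and its image under a are disjoint and cover the orbit.
    Hence the valence is the length of a rho-cycle. *)
Lemma card_dihedral_orbit x :
  #|dihedral_orbit a b x| = #|porbit rho x|.*2.
Proof.
set O := dihedral_orbit a b x; set C := porbit rho x.
have OE y : y \in O -> (y \in C) || (a y \in C).
  have /subsetP OS : O \subset [set y | (y \in C) || (a y \in C)].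
    apply: dihedral_orbit_sub => [|z|z]; rewrite !inE ?porbit_id //.
      by rewrite aK orbC.
    case/orP=> zC; apply/orP; [right | left].
      by rewrite -rhoVE -mem_porbit_step permKV.
    by rewrite -(aK z) -rhoE mem_porbit_step.
  by move/OS; rewrite inE.
have sCO : C \subset O.
  apply/subsetP => y /porbitP[k ->]; elim: k => [|k IHk].
    by rewrite perm1 orbit_refl.
  by rewrite expgSr permM rhoE; apply/dihedral_orbit_stepr/dihedral_orbit_stepl.
rewrite (@card_swap a O C) ?(setIidPr sCO) // => [y|y yO].
  exact: dihedral_orbit_stepl.
apply/idP/idP => [/reflection_notin_porbit|/negPf yC]; first by rewrite aK.
by have := OE y yO; rewrite yC.
Qed.

(** The flags rho ^ (2 i) x, together with their images under b, form the
    candidate P.  With its image under a it covers the orbit, which has 2n flags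
    where n is the length of the rho-cycle of x.  As n is even, rho ^ 2 returns
    to x after n / 2 steps, so P has at most n flags: P and its image under a
    are therefore disjoint. *)
Lemma alternating_on_orbit x : ~~ odd (#|dihedral_orbit a b x|./2) ->
  exists P, [forall y in dihedral_orbit a b x,
    ((a y \in P) == (y \notin P)) && ((b y \in P) == (y \in P))].
Proof.
rewrite card_dihedral_orbit doubleK => n_even.
set O := dihedral_orbit a b x; set n := #|porbit rho x| in n_even.
have nE : n = n./2.*2 by rewrite -[LHS]odd_double_half (negPf n_even).
have n2_gt0 : 0 < n./2.
  by rewrite -double_gt0 -nE; apply/card_gt0P; exists x; apply: porbit_id.
pose Q := porbit (rho ^+ 2)%g x.
have Q_card : #|Q| <= n./2.
  apply: card_porbit_le => //; rewrite -expgM mul2n -nE.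
  by rewrite permX iter_porbit.
have Q_step y : (rho (rho y) \in Q) = (y \in Q).
  by rewrite /Q -[RHS]mem_porbit_step -!permM.
pose P := [set y | (y \in Q) || (b y \in Q)].
have PbE y : (b y \in P) = (y \in P) by rewrite !inE bK orbC.
have P_card : #|P| <= n.
  have -> : P = Q :|: b @^-1: Q by apply/setP => y; rewrite !inE.
  rewrite (leq_trans (leq_card_setU _ _)) // card_preimset; last exact: perm_inj.
  by rewrite addnn nE leq_double.
have O_cover : O \subset P :|: a @: P.
  apply: dihedral_orbit_sub => [|y|y].
  - by rewrite !inE porbit_id.
  - case/setUP => [yP|/imsetP[z zP ->]]; last by rewrite aK inE zP.
    by rewrite inE imset_f ?orbT.
  case/setUP => [yP|/imsetP[z zP ->]]; first by rewrite inE PbE yP.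
  rewrite inE -[b (a z)]aK imset_f ?orbT //.
  move: zP; rewrite !inE => /orP[zQ|bzQ]; apply/orP; [right | left].
    by rewrite -!rhoE Q_step.
  by rewrite -Q_step !rhoE aK bK aK.
have disj : [disjoint P & a @: P].
  rewrite -leq_card_setU; apply/eqP/anti_leq.
  rewrite leq_card_setU /= card_imset; last exact: perm_inj.
  rewrite (leq_trans _ (subset_leq_card O_cover)) // card_dihedral_orbit.
  by rewrite addnn leq_double.
exists P; apply/forall_inP => y yO; rewrite PbE eqxx andbT; apply/eqP.
have aP z : (z \in a @: P) = (a z \in P).
  by rewrite -{1}[z]aK mem_imset //; apply: perm_inj.
apply/idP/idP => [ayP|yP]; first by rewrite (disjointFl disj) ?aP.
by have /setUP[/(negP yP)[] | ] := subsetP O_cover y yO; rewrite aP.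
Qed.

Definition alternating P :=
  (forall x, (a x \in P) = (x \notin P)) /\ (forall x, (b x \in P) = (x \in P)).

(** Given P, the involution a shows that P contains exactly half of each orbit,
    and b pairs off the flags in that half, so its size is even.  The converse
    glues the sets found on the separate orbits. *)
Lemma alternating_setP :
  (forall x, ~~ odd (#|dihedral_orbit a b x|./2)) <-> exists P, alternating P.
Proof.
split=> [even_orb | [P [aP bP]] x]; last first.
  have aO := @dihedral_orbit_stepl a b x; have bO := @dihedral_orbit_stepr a b x.
  rewrite (card_swap aO aK (fun y _ => aP y)) doubleK.
  apply: (ff_involution_even b_ffi) => y; rewrite !inE bP.
  by case/andP=> /bO -> ->.
(* Choosing P by the orbit rather than by the flag makes the choice the same at
   all flags of an orbit. *)
pose good (v P : {set X}) := [forall y in v,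
  ((a y \in P) == (y \notin P)) && ((b y \in P) == (y \in P))].
pose col v := odflt set0 [pick P | good v P].
have colP x : good (dihedral_orbit a b x) (col (dihedral_orbit a b x)).
  rewrite /col; case: pickP => //= no_good.
  by have [P] := alternating_on_orbit (even_orb x); rewrite -/(good _ P) no_good.
exists [set x | x \in col (dihedral_orbit a b x)].
have xO x : x \in dihedral_orbit a b x by apply: orbit_refl.
split=> x; rewrite !inE;
  have /forall_inP/(_ x (xO x))/andP[/eqP aE /eqP bE] := colP x.
  by rewrite (dihedral_orbit_eq (dihedral_orbit_stepl (xO x))).
by rewrite (dihedral_orbit_eq (dihedral_orbit_stepr (xO x))).
Qed.

End Pair.
End Alternating.

(** * Types of hyperedges as invariance of the sign *)

Lemma eulerian_alternating (X : finType) (K : hypermap X) :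
  eulerian K <-> exists P, alternating (tau1 K) (tau2 K) P.
Proof.
apply: iff_trans (alternating_setP (tau1_ffi K) (tau2_ffi K)).
split=> [eulK x | eulK v /imsetP[x _ ->]]; last exact: eulK.
by apply/eulK/imset_f.
Qed.

Lemma hyperedge_eq (X : finType) (H : hypermap X) e x :
  e \in hyperedges H -> x \in e -> e = hyperedge_of H x.
Proof. by case/imsetP=> z _ -> /orbit_eqP. Qed.

Lemma mem_cover_hyperedge (X : finType) (H : hypermap X) (A : {set {set X}}) e x :
  A \subset hyperedges H -> e \in hyperedges H -> x \in e ->
  (x \in cover A) = (e \in A).
Proof.
move=> /subsetP hA eE xe; apply/bigcupP/idP => [[e' e'A xe']|eA]; last by exists e.
by rewrite (hyperedge_eq eE xe) -(hyperedge_eq (hA _ e'A) xe').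
Qed.

Section SignTypes.

Variables (X : finType) (H : hypermap X) (Omega : orientation (medial H)).
Let delta := delta Omega.

Lemma delta_pm1 x : delta x = 1%R \/ delta x = (-1)%R.
Proof. by rewrite /delta /Defs.delta; case: ifP; [left | right]. Qed.

Definition sign_invariant (t : {perm X}) (e : {set X}) :=
  [forall x in e, delta (t x) == delta x].

(** The hyperedge is one orbit of tau0 and tau2, so a function on it is constant
    iff it is invariant under both. *)
Lemma t_typeE e : e \in hyperedges H ->
  t_type Omega e = sign_invariant (tau0 H) e && sign_invariant (tau2 H) e.
Proof.
case/imsetP=> z _ ->; apply/idP/andP => [t_e | [inv0 inv2]].
  have step s x : s \in [set tau0 H; tau2 H] -> x \in hyperedge_of H z ->
      delta (s x) == delta x.
    move=> sS xe; move/forall_inP/(_ _ (gen_orbit_step sS xe))/forall_inP: t_e.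
    exact.
  by split; apply/forall_inP => x; apply: step; rewrite !inE eqxx ?orbT.
have const x : x \in hyperedge_of H z -> delta x == delta z.
  move=> xe; have: (x \in hyperedge_of H z) && (delta x == delta z).
    pose P y := (y \in hyperedge_of H z) && (delta y == delta z).
    apply: (@gen_orbit_ind _ _ P _ _ _ _ xe) => [s y sS /andP[ye /eqP ey]|]; last first.
      by rewrite /P orbit_refl eqxx.
    rewrite /P (gen_orbit_step sS ye) -ey /=.
    move: sS; rewrite !inE => /orP[] /eqP ->.
      exact: (forall_inP inv0).
    exact: (forall_inP inv2).
  by case/andP.
apply/forall_inP => x xe; apply/forall_inP => y ye.
by rewrite -/delta (eqP (const x xe)) (eqP (const y ye)).
Qed.

Lemma t_or_d_typeE e : e \in hyperedges H ->
  t_type Omega e || d_type Omega e = sign_invariant (tau0 H) e.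
Proof.
move=> eE; rewrite /d_type -/(sign_invariant _ e) t_typeE //.
by case: (sign_invariant _ e); case: (sign_invariant _ e).
Qed.

Lemma t_or_c_typeE e : e \in hyperedges H ->
  t_type Omega e || c_type Omega e = sign_invariant (tau2 H) e.
Proof.
move=> eE; rewrite /c_type -/(sign_invariant _ e) t_typeE //.
by case: (sign_invariant (tau0 H) e); case: (sign_invariant _ e).
Qed.

Lemma pdual_tau2_invariantP (A : {set {set X}}) (hA : A \subset hyperedges H) :
  (forall x, delta (tau2 (partial_dual hA) x) = delta x) <->
  (forall e, e \in hyperedges H ->
     t_type Omega e || (if e \in A then d_type Omega e else c_type Omega e)).
Proof.
have tau2E e x : e \in hyperedges H -> x \in e ->
    tau2 (partial_dual hA) x = if e \in A then tau0 H x else tau2 H x.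
  by move=> eE xe; rewrite permE /pdual2_fun (mem_cover_hyperedge hA eE xe).
split=> [inv e eE | types x].
  case: ifP => eA; rewrite ?t_or_d_typeE ?t_or_c_typeE //;
    by apply/forall_inP => x xe; rewrite -[eqbRHS]inv (tau2E e) ?eA.
have eE : hyperedge_of H x \in hyperedges H by apply: imset_f.
have xe : x \in hyperedge_of H x by apply: orbit_refl.
rewrite (tau2E _ _ eE xe); have := types _ eE.
by case: ifP => _; rewrite ?t_or_d_typeE ?t_or_c_typeE // =>
  /forall_inP/(_ x xe)/eqP.
Qed.

(** Only the t-type hyperedges are compatible both with being in A and with
    being outside it, which is why T' is an arbitrary subset of them. *)
Lemma crossing_total_pdualP (A : {set {set X}}) (hA : A \subset hyperedges H) :
  (exists T' : {set {set X}},
     [/\ crossing_total Omega, T' \subset t_set Omega & A = d_set Omega :|: T'])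
  <-> (forall x, delta (tau2 (partial_dual hA) x) = delta x).
Proof.
apply: (iff_trans _ (iff_sym (pdual_tau2_invariantP hA))); split=> [[T' [ct /subsetP T'T AE]] e eE|types].
  have := ct e eE; have [eA|eA] := boolP (e \in A).
    move: eA; rewrite AE => /setUP[|/T'T]; rewrite inE => /andP[_ ->] //.
    by rewrite orbT.
  move: eA; rewrite AE !inE eE /= negb_or => /andP[/negPf -> _].
  by rewrite orbF.
exists (A :&: t_set Omega); split; last 1 first.
- apply/setP => e; rewrite !inE.
  have [eE|eE] := boolP (e \in hyperedges H); last first.
    by rewrite (contraNF (subsetP hA e) eE).
  have := types e eE; case: ifP => _ /=; first by rewrite orbC => ->.
  (* A d-type hyperedge outside A would also be of t-type or c-type, hence
     invariant under both involutions. *)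
  rewrite orbF t_or_c_typeE // => inv2; apply/esym/negP => de.
  have inv0 : sign_invariant (tau0 H) e by rewrite -t_or_d_typeE // de orbT.
  by move: de; rewrite /d_type t_typeE // inv0 inv2.
- by move=> e /types; case: ifP => _ /orP[] ->; rewrite ?orbT.
- exact: subsetIr.
Qed.

End SignTypes.

(** * Eulerian partial duals *)

Theorem theorem4p2 (X : finType) (H : hypermap X) (A : {set {set X}})
    (hA : A \subset hyperedges H) :
  eulerian (partial_dual hA) <->
  exists (Omega : orientation (medial H)) (T' : {set {set X}}),
    [/\ crossing_total Omega, T' \subset t_set Omega
      & A = d_set Omega :|: T'].
Proof.
apply: (iff_trans (eulerian_alternating _)).
split=> [[P [aP bP]] | [Omega /(crossing_total_pdualP _ hA) inv]].
  pose f x : int := if x \in P then 1%R else (-1)%R.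
  have f_pm1 x : f x = 1%R \/ f x = (-1)%R.
    by rewrite /f; case: ifP; [left | right].
  have fN x : f (tau1 H x) = (- f x)%R.
    by rewrite /f aP; case: (x \in P); rewrite ?GRing.opprK.
  have [Omega fE] := delta_exists f_pm1 fN.
  exists Omega; apply/(crossing_total_pdualP _ hA) => x.
  by rewrite !fE /f bP.
exists [set x | delta Omega x == 1%R].
split=> x; rewrite !inE; last by rewrite inv.
by rewrite delta_tau1; case: (delta_pm1 Omega x) => ->.
Qed.
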